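(* Let $n \ge 1$ be an integer, let $j \in \{1,\dots,2n\}$, and let $N = n^2 + j$. The continued fraction of $\sqrt{N}$ has period of length $2$ if and only if $\frac{2n}{j}$ is an integer. In that case $\sqrt{N} = [n, \overline{\tfrac{2n}{j}, 2n}]$.
   Context: The (simple) continued fraction expansion of an irrational real number $x$ is the unique infinite sequence $[a_0,a_1,a_2,\dots]$ with $a_0\in\mathbb Z$ and $a_i$ a positive integer for $i\ge 1$, such that the convergents $a_0+\cfrac{1}{a_1+\cfrac{1}{\ddots+\cfrac{1}{a_m}}}$ converge to $x$ as $m\to\infty$. The notation $[a_0,\dots,a_k,\overline{a_{k+1},\dots,a_\ell}]$ means that the block $a_{k+1},\dots,a_\ell$ is repeated infinitely many times after the preperiod $a_0,\dots,a_k$. For $N=n^2+j$ with $1\le j\le 2n$, the continued fraction of $\sqrt N$ has the form $[n,\overline{a_1,\dots,a_r,2n}]$. To say that it ''has period of length $\ell$'' means that it can be written in the form $[n,\overline{a_1,\dots,a_{\ell-1},2n}]$ with a repeating block of $\ell$ entries; the block is not required to be of minimal length. *)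

(* Defs.v *)
From HB Require Import structures.
From mathcomp Require Import all_boot all_order all_algebra.
From mathcomp Require Import all_classical all_reals all_analysis.

Set Implicit Arguments.
Unset Strict Implicit.
Unset Printing Implicit Defensive.

Import Order.TTheory GRing.Theory Num.Theory.
Import numFieldNormedType.Exports.

Local Open Scope classical_set_scope.
Local Open Scope ring_scope.

(* a_0 + 1/(a_1 + 1/(... + 1/a_m)) *)
Fixpoint cf_convergent (R : realType) (a : nat -> int) (m : nat) : R :=
  match m with
  | 0%N => (a 0%N)%:~R
  | m'.+1 => (a 0%N)%:~R + (cf_convergent R (fun i => a i.+1) m')^-1
  end.

(* x = [a_0, a_1, a_2, ...] as an infinite simple continued fraction. *)
Definition is_cf_expansion (R : realType) (x : R) (a : nat -> int) : Prop :=
  (forall i, (0 < i)%N -> 0 < a i) /\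
  cf_convergent R a m @[m --> \oo] --> x.

(* The sequence with preperiod p followed by the block b repeated forever;
   meant for nonempty b. *)
Definition preperiodic (p b : seq int) (i : nat) : int :=
  if (i < size p)%N then p`_i else b`_((i - size p) %% size b).

(* x = [n, \overline{a_1, ..., a_(l-1), 2n}]; the repeating block has l entries
   but need not be of minimal length. *)
Definition has_cf_period (R : realType) (n : nat) (x : R) (l : nat) : Prop :=
  exists s : seq int,
    (size s).+1 = l /\
    is_cf_expansion x (preperiodic [:: n%:Z] (rcons s (2 * n)%N%:Z)).

(* Main.v *)
(* The convergents [c_m] of [n, k, 2n, k, 2n, ...] satisfy
   [c_(m+2) = n + 1/(k + 1/(n + c_m))].  The positive fixed point of this
   recursion is [sqrt (n^2 + 2n/k)], and the map contracts distances to it by at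
   least a factor 4, so the convergents tend to it.  By uniqueness of limits,
   [sqrt (n^2 + j)] has such an expansion exactly when [j = 2n/k]. *)

Require Import Defs.
From HB Require Import structures.
From mathcomp Require Import all_boot all_order all_algebra.
From mathcomp Require Import all_classical all_reals all_analysis.
From mathcomp Require Import ring lra.

Set Implicit Arguments.
Unset Strict Implicit.
Unset Printing Implicit Defensive.

Import Order.TTheory GRing.Theory Num.Theory.
Import numFieldNormedType.Exports.

Local Open Scope classical_set_scope.
Local Open Scope ring_scope.

Lemma eq_cf_convergent (R : realType) (a b : nat -> int) (m : nat) :
  a =1 b -> cf_convergent R a m = cf_convergent R b m.
Proof. by move=> /funext ->. Qed.

(** The entry at index 0 is a summand outside all fractions. This allows a leading [2n] in a shifted
    period to be traded for [n]. *)
Lemma cf_convergent_head (R : realType) (a b : nat -> int) (m : nat) :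
  (forall i, a i.+1 = b i.+1) ->
  cf_convergent R a m = (a 0%N - b 0%N)%:~R + cf_convergent R b m.
Proof.
move=> ab; case: m => [|m] /=; first by rewrite rmorphB /= subrK.
by rewrite (eq_cf_convergent R m ab) rmorphB /= addrA subrK.
Qed.

Lemma cvg_two_step_contraction (R : realType) (c : nat -> R) (x : R) :
  (forall m, `|c m.+2 - x| <= `|c m - x| / 4) -> c m @[m --> \oo] --> x.
Proof.
(* A factor 1/4 over two steps amounts to 1/2 per step; the weight 2 makes [D / 2] dominate the
   error at index 1. *)
move=> contr; pose D := `|c 0%N - x| + 2 * `|c 1%N - x|.
have bound m : `|c m - x| <= D * 2^-1 ^+ m.
  (* [contr] links [m] to [m.+2], so the induction carries two consecutive bounds. *)
  suff [] : `|c m - x| <= D * 2^-1 ^+ m /\ `|c m.+1 - x| <= D * 2^-1 ^+ m.+1.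
    by [].
  have c0 := normr_ge0 (c 0%N - x); have c1 := normr_ge0 (c 1%N - x).
  elim: m => [|m [IHm IHm1]]; first by rewrite expr0 expr1 /D; split; lra.
  split=> //; apply: (le_trans (contr m)).
  by rewrite !exprS; move: IHm; set e := 2^-1 ^+ m; lra.
have D0 : D * 2^-1 ^+ m @[m --> \oo] --> (0 : R).
  rewrite -[X in _ --> X](mulr0 D); apply: cvgMl_tmp; apply: cvg_expr.
  by rewrite ger0_norm; lra.
apply/subr_cvg0/norm_cvg0P.
apply: (squeeze_cvgr _ (cvg_cst 0) D0).
by apply: nearW => m; rewrite normr_ge0 bound.
Qed.

Section PeriodTwo.
Variables (R : realType) (n : nat) (k : int).
Hypotheses (n_gt0 : (0 < n)%N) (k_gt0 : 0 < k).

Let a := preperiodic [:: n%:Z] [:: k; (2 * n)%N%:Z].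
Let x : R := Num.sqrt (n%:R ^+ 2 + (2 * n)%:R / k%:~R).

Lemma preperiodic2_gt0 i : 0 < a i.
Proof.
case: i => [//|i]; rewrite /a /preperiodic /= subSS subn0.
have := ltn_pmod i (isT : (0 < 2)%N).
by case: (i %% 2)%N => [|[|]] //= _; rewrite ltz_nat muln_gt0.
Qed.

Lemma cf_convergent_period2S m :
  cf_convergent R a m.+2 =
    n%:R + (k%:~R + (n%:R + cf_convergent R a m)^-1)^-1.
Proof.
rewrite [LHS]/=; congr (_ + (_ + _^-1)^-1).
(* Past its first two entries the expansion reads [2n, k, 2n, ...], which differs from [a] only at
   the head, by [2n - n = n]. *)
rewrite (@cf_convergent_head R _ a) => [|i].
  rewrite /a /preperiodic /=; congr (_ + _).
  by rewrite mul2n -addnn PoszD addrK.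
by rewrite /a /preperiodic /= !subSS !subn0 -[in RHS](modnDr i 2) addn2.
Qed.

(** Keeps the convergents positive, so that the denominators in the contraction estimate are bounded
    below. *)
Lemma cf_convergent_period2_ge m : n%:R <= cf_convergent R a m.
Proof.
have k0 : 0 <= k%:~R :> R by rewrite ler0z ltW.
suff [] : n%:R <= cf_convergent R a m /\ n%:R <= cf_convergent R a m.+1 by [].
elim: m => [|m [IHm IHm1]].
  by split=> //=; rewrite lerDl invr_ge0.
split=> //; rewrite cf_convergent_period2S lerDl invr_ge0 addr_ge0 //.
by rewrite invr_ge0 addr_ge0 ?ler0n // (le_trans _ IHm).
Qed.

Lemma cvg_cf_period2 : cf_convergent R a m @[m --> \oo] --> x.
Proof.
apply: cvg_two_step_contraction => m.
rewrite cf_convergent_period2S.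
have := cf_convergent_period2_ge m; set c := cf_convergent R a m => nc.
have n1 : 1 <= n%:R :> R by rewrite ler1n.
have k1 : 1 <= k%:~R :> R by rewrite ler1z -gtz0_ge1.
have x0 : 0 <= x by rewrite sqrtr_ge0.
have x2 : x ^+ 2 = n%:R ^+ 2 + 2 * n%:R / k%:~R.
  rewrite sqr_sqrtr ?natrM // addr_ge0 ?sqr_ge0 // divr_ge0 //; lra.
move: x0 x2 nc n1 k1; move: (x) c n%:R k%:~R => y c ν κ y0 y2 νc ν1 κ1.
have κ0 : κ != 0 by rewrite gt_eqF //; lra.
have yfix : y = ν + (κ + (ν + y)^-1)^-1.
  (* This is the fixed-point equation with its denominators cleared. *)
  have κy : κ * y ^+ 2 = κ * ν ^+ 2 + 2 * ν by rewrite y2; field.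
  have d1 : ν + y != 0 by rewrite gt_eqF //; lra.
  have d2 : κ * (ν + y) + 1 != 0.
    by rewrite gt_eqF // ltr_wpDl // mulr_ge0; lra.
  have -> : (κ + (ν + y)^-1)^-1 = (ν + y) / (κ * (ν + y) + 1).
    by field; rewrite d1 d2.
  apply: (mulIf d2); rewrite mulrDl divfK //; nra.
(* The recursion is a Möbius map of determinant 1, and [P], [Q] are its denominators at [c] and [y].
   Hence the difference of the two images is [(c - y) / (P * Q)], and [P * Q >= 4] gives the factor
   1/4. *)
pose P := κ * (ν + c) + 1; pose Q := κ * (ν + y) + 1.
have P2 : 2 <= P by rewrite /P; nra.
have Q2 : 2 <= Q by rewrite /Q; nra.
have -> : ν + (κ + (ν + c)^-1)^-1 - y = (c - y) / (P * Q).
  rewrite {1}yfix /P /Q; field.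
  rewrite -/P -/Q; apply/and4P; split; rewrite gt_eqF //; lra.
rewrite normrM normfV (ger0_norm (_ : 0 <= P * Q)); last by nra.
by rewrite ler_wpM2l // lef_pV2 ?posrE; nra.
Qed.

Lemma is_cf_expansion_period2 : is_cf_expansion x a.
Proof. by split; [move=> i _; exact: preperiodic2_gt0 | exact: cvg_cf_period2]. Qed.

End PeriodTwo.

Theorem mainTheorem1 (R : realType) (n j : nat)
    (hn : (1 <= n)%N) (hj : (1 <= j <= 2 * n)%N) :
  let sqrtN : R := Num.sqrt (n ^ 2 + j)%N%:R in
  let q : R := (2 * n)%N%:R / j%:R in
  (has_cf_period n sqrtN 2 <-> q \is a Num.int) /\
  (forall k : int, k%:~R = q ->
     is_cf_expansion sqrtN (preperiodic [:: n%:Z] [:: k; (2 * n)%N%:Z])).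
Proof.
move=> sqrtN q; case/andP: hj => j_gt0 _.
have j0 : 0 < j%:R :> R by rewrite ltr0n.
have n0 : 0 < (2 * n)%:R :> R by rewrite ltr0n muln_gt0.
have expansion (k : int) : k%:~R = q ->
    is_cf_expansion sqrtN (preperiodic [:: n%:Z] [:: k; (2 * n)%N%:Z]).
  move=> kq; have k0 : 0 < k by rewrite -(ltr0z R) kq divr_gt0.
  suff -> : sqrtN = Num.sqrt (n%:R ^+ 2 + (2 * n)%:R / k%:~R).
    exact: is_cf_expansion_period2.
  by rewrite /sqrtN natrD natrX kq invf_div mulrC divfK // gt_eqF.
(* Length 2 forces the block to be one entry [k] followed by [2n]. *)
split=> //; split=> [[[|k [|? ?]] [] // _ [apos acvg]]|].
  have k0 : 0 < k by have := apos 1%N isT.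
  have kR0 : 0 < k%:~R :> R by rewrite ltr0z.
  have sqrtE : sqrtN = Num.sqrt (n%:R ^+ 2 + (2 * n)%:R / k%:~R).
    by apply: (cvg_unique (@norm_hausdorff _ _) acvg); exact: cvg_cf_period2.
  (* Squaring and cancelling the square of [n] leaves [j = 2n / k], so [q] is the integer [k]. *)
  have {sqrtE} := congr1 (fun y : R => y ^+ 2) sqrtE.
  rewrite !sqr_sqrtr ?ler0n // ?addr_ge0 ?sqr_ge0 ?divr_ge0 ?ltW //.
  rewrite natrD natrX => /addrI jE.
  suff -> : q = k%:~R by rewrite rpred_int.
  by rewrite /q jE invf_div mulrC divfK // gt_eqF.
by move=> /intrP [k qk]; exists [:: k]; split=> //; exact: expansion.
Qed.
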